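(* Let $\lambda_2,\lambda_3$ be real numbers with $0 < \lambda_2 \leq \lambda_3$. Then $\{0, \lambda_2, \lambda_3\}$ (as a multiset) is Laplacian realizable for the path $P_3$ on three vertices if and only if $\lambda_3 \geq 3\lambda_2$.
   Context: For a finite simple graph $G$ on $n$ vertices, $\mathcal{S}_L(G)$ denotes the set of $n\times n$ real symmetric matrices $A=[a_{i,j}]$ such that $a_{i,j}<0$ if $\{i,j\}\in E(G)$, $a_{i,j}=0$ if $i\neq j$ and $\{i,j\}\notin E(G)$, and $a_{i,i}=-\sum_{k\neq i}a_{i,k}$ for all $i$. A multiset $\{0,\lambda_2,\ldots,\lambda_n\}$ of real numbers is Laplacian realizable for $G$ if there is $A\in\mathcal{S}_L(G)$ whose spectrum (multiset of eigenvalues) is $\{0,\lambda_2,\ldots,\lambda_n\}$. *)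

(* Defs.v *)
From HB Require Import structures.
From mathcomp Require Import all_boot all_order all_algebra.
From mathcomp Require Import reals.

Set Implicit Arguments.
Unset Strict Implicit.
Unset Printing Implicit Defensive.

Import Order.TTheory GRing.Theory Num.Theory.
Local Open Scope ring_scope.

Record sgraph (n : nat) := SGraph {
  edge :> rel 'I_n;
  edge_sym : symmetric edge;
  edge_irrefl : irreflexive edge
}.

Definition path_edge (n : nat) : rel 'I_n :=
  fun i j => (i.+1 == j :> nat) || (j.+1 == i :> nat).

Lemma path_edge_sym (n : nat) : symmetric (@path_edge n).
Proof. by move=> i j; rewrite /path_edge orbC. Qed.

Lemma path_edge_irrefl (n : nat) : irreflexive (@path_edge n).
Proof. by move=> i; rewrite /path_edge orbb; apply/negbTE; rewrite neq_ltn ltnSn orbT. Qed.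

Definition path_graph (n : nat) : sgraph n :=
  SGraph (@path_edge_sym n) (@path_edge_irrefl n).

(* The set S_L(G) of generalized Laplacian matrices of G. *)
Definition SL (R : realType) (n : nat) (G : sgraph n) (A : 'M[R]_n) : Prop :=
  [/\ A^T = A,
      forall i j, G i j -> A i j < 0,
      forall i j, i != j -> ~~ G i j -> A i j = 0 &
      forall i, A i i = - \sum_(k < n | k != i) A i k].

(* Multisets are represented by sequences. The spectrum is counted with
   algebraic multiplicity and is required to split over R; the product does not
   depend on the order of s, so this only depends on s as a multiset. *)
Definition is_spectrum (R : realType) (n : nat) (A : 'M[R]_n) (s : seq R) : Prop :=
  char_poly A = \prod_(x <- s) ('X - x%:P).

Definition laplacian_realizable (R : realType) (n : nat) (G : sgraph n)
    (s : seq R) : Prop :=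
  exists A : 'M[R]_n, SL G A /\ is_spectrum A s.

(* Main.v *)
Require Import Defs.
From mathcomp Require Import all_boot all_order all_algebra.
From mathcomp Require Import reals.
From mathcomp Require Import ring lra.
Import Order.TTheory GRing.Theory Num.Theory.
Local Open Scope ring_scope.

(** The weighted Laplacians of P_3 form the two-parameter family
      [[a, -a, 0], [-a, a + b, -b], [0, -b, b]],   a, b > 0,
    where a and b are the weights of the two edges ([SL_path3P]).  The
    characteristic polynomial of such a matrix is
    X (X^2 - 2 (a + b) X + 3 a b) ([char_poly_path3]), so {0, x, y} is its
    spectrum exactly when x + y = 2 (a + b) and x y = 3 a b ([spectrum_path3P]),
    and realizability asks for two positive reals with sum (x + y) / 2 and
    product x y / 3.  As x and y are positive, they exist if and only if the
    discriminant (x + y)^2 / 4 - 4 x y / 3 is nonnegative; this number equals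
    (y - 3 x) (3 y - x) / 12, and 3 y - x > 0 when 0 < x <= y, so the condition
    is y >= 3 x. *)

Definition path3_laplacian {R : realType} (a b : R) : 'M[R]_3 :=
  \matrix_(i, j)
    nth 0 (nth [::] [:: [:: a; - a; 0];
                        [:: - a; a + b; - b];
                        [:: 0; - b; b]] i) j.

Lemma SL_path3P (R : realType) (A : 'M[R]_3) :
  SL (path_graph 3) A <->
  exists a b : R, [/\ 0 < a, 0 < b & A = path3_laplacian a b].
Proof.
pose i0 : 'I_3 := ord0; pose i1 : 'I_3 := Ordinal (isT : (1 < 3)%N).
pose i2 : 'I_3 := Ordinal (isT : (2 < 3)%N).
split=> [[Asym Aneg Anul Adiag]|[a [b [a_gt0 b_gt0 ->]]]].
  have A01 : A i0 i1 < 0 by exact: Aneg.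
  have A12 : A i1 i2 < 0 by exact: Aneg.
  have A02 : A i0 i2 = 0 by exact: Anul.
  have symA i j : A j i = A i j by rewrite -{1}Asym mxE.
  have D0 : A i0 i0 = - A i0 i1.
    rewrite Adiag big_mkcond !big_ord_recl big_ord0 /= add0r addr0.
    rewrite (_ : lift ord0 (lift ord0 ord0) = i2); last exact: val_inj.
    rewrite A02 addr0.
    by congr (- A _ _); exact: val_inj.
  have D1 : A i1 i1 = - (A i0 i1 + A i1 i2).
    rewrite Adiag big_mkcond !big_ord_recl big_ord0 /= add0r addr0 symA.
    by congr (- (A _ _ + A _ _)); exact: val_inj.
  have D2 : A i2 i2 = - A i1 i2.
    rewrite Adiag big_mkcond !big_ord_recl big_ord0 /= !addr0 symA A02 add0r symA.
    by congr (- A _ _); exact: val_inj.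
  exists (- A i0 i1), (- A i1 i2); rewrite !oppr_gt0; split=> //.
  apply/matrixP=> i j; rewrite mxE.
  have ordE (k : 'I_3) : [\/ k = i0, k = i1 | k = i2].
    by case: k => -[|[|[|//]]] ?; [constructor 1|constructor 2|constructor 3];
      exact: val_inj.
  case: (ordE i) => ->; case: (ordE j) => -> /=;
    rewrite ?opprK ?D0 ?D1 ?D2 ?A02 ?opprD //.
  by rewrite symA.
split.
- by apply/matrixP=> -[[|[|[|//]]] ?] [[|[|[|//]]] ?]; rewrite !mxE.
- by move=> [[|[|[|//]]] ?] [[|[|[|//]]] ?] //= _; rewrite !mxE /= oppr_lt0.
- by move=> [[|[|[|//]]] ?] [[|[|[|//]]] ?] //= _ _; rewrite !mxE.
- move=> [[|[|[|//]]] ?]; rewrite big_mkcond !big_ord_recl big_ord0 /= !mxE /=; ring.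
Qed.

Lemma det_mx22 (R : comPzRingType) (M : 'M[R]_2) :
  \det M = M 0 0 * M 1 1 - M 0 1 * M 1 0.
Proof.
rewrite (expand_det_row _ ord0) !big_ord_recl big_ord0 /cofactor !det_mx11.
rewrite !mxE /= addr0 expr0 expr1 mul1r mulN1r mulrN.
by congr (_ * M _ _ - M _ _ * M _ _); exact: val_inj.
Qed.

Lemma char_poly_path3 (R : realType) (a b : R) :
  char_poly (path3_laplacian a b) =
  'X * ('X ^+ 2 - (2 * (a + b))%:P * 'X + (3 * a * b)%:P).
Proof.
rewrite /char_poly (expand_det_row _ ord0) !big_ord_recl big_ord0 /cofactor.
rewrite !det_mx22 !mxE /=.
rewrite !(polyCN, polyCM, polyCD, polyC0, polyC1) /bump /=.
ring.
Qed.

(** Vieta's relations for the nonzero eigenvalues. *)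
Lemma spectrum_path3P (R : realType) (a b x y : R) :
  is_spectrum (path3_laplacian a b) [:: 0; x; y] <->
  x + y = 2 * (a + b) /\ x * y = 3 * a * b.
Proof.
rewrite /is_spectrum char_poly_path3 !big_cons big_nil; split=> [eqP|[sumE prodE]].
  (* Evaluating at 1 and -1 gives two linear equations in the sum and the
     product; evaluating at x and y would lose information when x = y. *)
  have eq_at z := congr1 (fun p : {poly R} => p.[z]) eqP.
  have := eq_at 1; have := eq_at (-1); rewrite !hornerE /= => ? ?.
  by split; lra.
rewrite -sumE -prodE polyCD polyCM; ring.
Qed.

Theorem proposition2p3 (R : realType) (lambda2 lambda3 : R)
    (h2 : 0 < lambda2) (h23 : lambda2 <= lambda3) :
  laplacian_realizable (path_graph 3) [:: 0; lambda2; lambda3] <->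
  lambda3 >= 3 * lambda2.
Proof.
split=> [[A [/SL_path3P[a [b [_ _ ->]]] /spectrum_path3P[sumE prodE]]]|le3].
  (* The product is 12 times the discriminant (a - b)^2. *)
  have discr_ge0 : 0 <= (lambda3 - 3 * lambda2) * (3 * lambda3 - lambda2).
    have -> : (lambda3 - 3 * lambda2) * (3 * lambda3 - lambda2) =
              3 * (lambda2 + lambda3) ^+ 2 - 16 * (lambda2 * lambda3) by ring.
    have -> : 3 * (lambda2 + lambda3) ^+ 2 - 16 * (lambda2 * lambda3) =
              12 * (a - b) ^+ 2 by rewrite sumE prodE; ring.
    by rewrite mulr_ge0 ?sqr_ge0.
  by rewrite -subr_ge0 -(pmulr_lge0 _ (_ : 0 < 3 * lambda3 - lambda2)) //; lra.
(* The weights are the roots (s + r) / 2 and (s - r) / 2 of T^2 - s T + p. *)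
pose s := (lambda2 + lambda3) / 2; pose p := lambda2 * lambda3 / 3.
pose r := Num.sqrt (s ^+ 2 - 4 * p).
have r_sqr : r ^+ 2 = s ^+ 2 - 4 * p.
  apply: sqr_sqrtr; rewrite /s /p.
  have -> : ((lambda2 + lambda3) / 2) ^+ 2 - 4 * (lambda2 * lambda3 / 3) =
            (lambda3 - 3 * lambda2) * (3 * lambda3 - lambda2) / 12 by field.
  by rewrite divr_ge0 ?mulr_ge0 //; lra.
have p_gt0 : 0 < p by rewrite divr_gt0 ?mulr_gt0 //; lra.
have s_gt0 : 0 < s by rewrite divr_gt0 //; lra.
have r_lt : r < s.
  by rewrite -(ltr_pXn2r (_ : 0 < 2)%N) ?nnegrE ?sqrtr_ge0 ?ltW // r_sqr; lra.
have r_ge0 : 0 <= r := sqrtr_ge0 _.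
exists (path3_laplacian ((s + r) / 2) ((s - r) / 2)); split.
  by apply/SL_path3P; exists ((s + r) / 2), ((s - r) / 2); split=> //; lra.
apply/spectrum_path3P; split; first by rewrite /s; field.
have -> : 3 * ((s + r) / 2) * ((s - r) / 2) = 3 / 4 * (s ^+ 2 - r ^+ 2) by field.
by rewrite r_sqr /p; field.
Qed.
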